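(* Let $r \ge 295$ be a fixed odd number. Then there exists $c < 1$ such that $$f_r(n) \le c\,(1+o(1))\binom{n}{\lfloor r/2 \rfloor},$$ where the $o(1)$ term is as $n \to \infty$ with $r$ fixed.
   Context: For $n \ge r \ge 1$, $K_n^{(r)}$ denotes the complete $r$-uniform hypergraph on $n$ vertices, i.e. the collection of all $r$-element subsets of an $n$-element vertex set. A complete $r$-partite $r$-graph is an $r$-uniform hypergraph whose edge set is, for some pairwise disjoint non-empty vertex sets $A_1,\dots,A_r$, the collection of all $r$-sets containing exactly one vertex from each $A_i$. $f_r(n)$ denotes the minimum number of complete $r$-partite $r$-graphs (on subsets of the vertex set) whose edge sets partition the edge set of $K_n^{(r)}$. *)

(* Defs.v *)
From mathcomp Require Import all_boot.

Set Implicit Arguments.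
Unset Strict Implicit.
Unset Printing Implicit Defensive.

(* An r-uniform hypergraph on the vertex set T is given by its edge set, of
   type {set {set T}}. *)

Definition complete_hypergraph (T : finType) (r : nat) : {set {set T}} :=
  [set e : {set T} | #|e| == r].

Definition rpartite_edges (T : finType) (r : nat) (A : {ffun 'I_r -> {set T}}) :
    {set {set T}} :=
  [set e : {set T} | (#|e| == r) && [forall i, #|e :&: A i| == 1]].

Definition complete_rpartite (T : finType) (r : nat) (H : {set {set T}}) : bool :=
  [exists A : {ffun 'I_r -> {set T}},
    [&& [forall i, A i != set0],
        [forall i, forall j, (i != j) ==> [disjoint A i & A j]] &
        H == rpartite_edges A]].

(* Complete r-partite r-graphs have at least one edge, so the edge sets of a
   decomposition are distinct and the decomposition may be taken to be a set;
   the exclusion of empty blocks in [partition] is harmless. *)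
Definition rpartite_decomposition (T : finType) (r : nat)
    (P : {set {set {set T}}}) : bool :=
  partition P (complete_hypergraph T r) &&
  [forall H in P, complete_rpartite r H].

Lemma single_edge_complete_rpartite (T : finType) (r : nat) (e : {set T}) :
  #|e| = r -> complete_rpartite r [set e].
Proof.
move=> er; subst r; apply/existsP.
exists [ffun i : 'I_#|e| => [set enum_val i]].
apply/and3P; split.
- by apply/forallP => i; rewrite ffunE; apply/set0Pn; exists (enum_val i); rewrite inE.
- apply/forallP => i; apply/forallP => j; apply/implyP => ij.
  rewrite !ffunE disjoints1 inE.
  by apply: contra ij => /eqP /enum_val_inj ->.
apply/eqP/setP => f; rewrite !inE; apply/eqP/andP => [->|[/eqP cf /forallP fA]].
  split=> //; apply/forallP => i; rewrite ffunE.
  have /setIidPr -> : [set enum_val i] \subset e by rewrite sub1set enum_valP.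
  by rewrite cards1.
apply/esym/eqP; rewrite eqEcard cf leqnn andbT.
apply/subsetP => x xe; have := fA (enum_rank_in xe x).
rewrite ffunE enum_rankK_in // => /cards1P[y fy].
have : y \in f :&: [set x] by rewrite fy inE.
by rewrite !inE => /andP[yf /eqP <-].
Qed.

Lemma rpartite_decomposition_exists (n r : nat) :
  exists k, [exists P : {set {set {set 'I_n}}},
    rpartite_decomposition r P && (#|P| == k)].
Proof.
set E := complete_hypergraph 'I_n r.
pose P := [set [set e] | e in E].
exists #|P|; apply/existsP; exists P; rewrite eqxx andbT; apply/andP; split.
  apply/and3P; split.
  - rewrite /cover; apply/eqP/setP => e; apply/bigcupP/idP.
      by case=> H /imsetP[f fE ->]; rewrite inE => /eqP ->.
    by move=> eE; exists [set e]; [apply: imset_f | rewrite inE].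
  - apply/trivIsetP => _ _ /imsetP[e _ ->] /imsetP[f _ ->] ef.
    by rewrite disjoints1 inE; apply: contra ef => /eqP ->.
  - by apply/imsetP => -[e _ /setP/(_ e)]; rewrite !inE eqxx.
apply/forallP => H; apply/implyP => /imsetP[e eE ->].
by apply: single_edge_complete_rpartite; move: eE; rewrite inE => /eqP.
Qed.

Definition f_ (r n : nat) : nat := ex_minn (rpartite_decomposition_exists n r).

(* Main.v *)
Require Import Defs.
From mathcomp Require Import all_boot.
From mathcomp Require Import zify.

Set Implicit Arguments.
Unset Strict Implicit.
Unset Printing Implicit Defensive.

(** Write r = 2d + 1.  Cut the n vertices into m cells of about L = n / m
    vertices and sort the r-sets by type, that is, by how many points t_i they
    have in the i-th cell.  Blocks on disjoint vertex sets concatenate to a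
    block, so decompositions multiply ([decompM]) and a type costs at most the
    product of the costs of its cells.  All j-subsets of a cell cost at most
    L ^ (j / 2), rounded down: fix every second point ([profile_decomp_layer]).
    Only types whose sum of floors of t_i / 2 equals d contribute to the order
    n ^ d; such a type has exactly one odd entry.  With no further idea the total
    exceeds the binomial coefficient, because the odd entry can sit in any cell.
    Two savings bring it down.

    - The pairs of edges of K_4 and K_6 split into 14, not 15, products of
      complete bipartite graphs ([product_tableP]).  As a large complete graph is
      an edge-disjoint union of blow-ups of K_4, and likewise of K_6, choosing two
      points in each of two cells costs q L ^ 2 with q = 14 / 15
      ([profile_decomp_pair]).  A type with j entries equal to two gains the
      factor q ^ (j / 2), rounded down.

    - When the odd entry is 1, its point may be anywhere outside the other
      occupied cells: one extra vertex class serves all its positions, so these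
      types are handled together ([singleton_profile], [sum_profiles]).

    What remains at order n ^ d is: two points in each of d cells and one point
    elsewhere, at cost binom(m, d) q ^ (d / 2) L ^ d; and three points in one cell
    and two in each of d - 1 others, at cost
    d binom(m, d) q ^ ((d - 1) / 2) L ^ d.  All other types of this order
    occupy, apart from a free point, fewer than d cells, so there are only
    O(m ^ (d - 1)) of them and their share vanishes as m grows
    ([f_le_type_count]).  As binom(m, d) L ^ d is asymptotically at most
    binom(n, d), the limiting ratio is arbitrarily close to
    q ^ (d / 2) + d q ^ ((d - 1) / 2), with exponents rounded down, which is below
    1 exactly when d reaches 147, i.e. r reaches 295 ([savings_lt1]). *)

(** * Blocks and decompositions *)

Section Blocks.

Variable T : finType.
Implicit Types (U W e : {set T}) (B : seq {set T}) (F G : {set T} -> nat).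

(** A block is the list of its vertex classes; empty classes are tolerated, such a
    block just has no edge. *)
Definition edge_of B e := (#|e| == size B) && all (fun A => #|e :&: A| == 1) B.

Definition parts_in U B :=
  all (fun A : {set T} => A \subset U) B && pairwise (fun A A' : {set T} => [disjoint A & A']) B.

(** The target F counts multiplicities, so that these statements can be added and
    multiplied; a genuine decomposition is the case of a 0-1 valued F. *)
Definition decomp U r F k :=
  exists D : seq (seq {set T}),
    [/\ size D <= k, all (fun B => (size B == r) && parts_in U B) D
      & forall e, \sum_(B <- D) edge_of B e = F e].

Lemma decomp_ext U r F G k : F =1 G -> decomp U r F k -> decomp U r G k.
Proof. by move=> FG [D [sD wfD eD]]; exists D; split=> // e; rewrite eD. Qed.

Lemma decomp_le U r F k l : k <= l -> decomp U r F k -> decomp U r F l.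
Proof. by move=> kl [D [sD wfD eD]]; exists D; split=> //; apply: leq_trans kl. Qed.

Lemma decomp_sub U W r F k : U \subset W -> decomp U r F k -> decomp W r F k.
Proof.
move=> UW [D [sD wfD eD]]; exists D; split=> //.
apply: sub_all wfD => B /and3P[-> BU pB]; rewrite /parts_in pB andbT /=.
by apply: sub_all BU => A /subset_trans; apply.
Qed.

Lemma decomp0 U r k : decomp U r (fun=> 0) k.
Proof. by exists [::]; split=> // e; rewrite big_nil. Qed.

Lemma decomp_block U B : parts_in U B -> decomp U (size B) (fun e => edge_of B e) 1.
Proof. by move=> BU; exists [:: B]; split=> [||e] //=; rewrite ?eqxx ?BU ?big_seq1. Qed.

Lemma decompD U r F G k l :
  decomp U r F k -> decomp U r G l -> decomp U r (fun e => F e + G e) (k + l).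
Proof.
move=> [D [sD wfD eD]] [E [sE wfE eE]]; exists (D ++ E); split.
- by rewrite size_cat leq_add.
- by rewrite all_cat wfD.
- by move=> e; rewrite big_cat /= eD eE.
Qed.

Lemma decomp_sum (I : Type) (s : seq I) (P : pred I) U r
    (F : I -> {set T} -> nat) (c : I -> nat) :
  (forall i, P i -> decomp U r (F i) (c i)) ->
  decomp U r (fun e => \sum_(i <- s | P i) F i e) (\sum_(i <- s | P i) c i).
Proof.
move=> dF; elim: s => [|i s IHs].
  by apply: decomp_ext (decomp0 U r _) => e; rewrite big_nil.
rewrite big_cons; case: ifPn => Pi.
  by apply: decomp_ext (decompD (dF i Pi) IHs) => e; rewrite big_cons Pi.
by apply: decomp_ext IHs => e; rewrite big_cons (negPf Pi).
Qed.

(** The classes of B are disjoint subsets of U, each met by e. *)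
Lemma size_parts_le U B e :
  parts_in U B -> all (fun A => #|e :&: A| == 1) B -> size B <= #|e :&: U|.
Proof.
elim: B U => [|A B IHB] U //= /andP[/= /andP[AU BU] /andP[AB pB]] /andP[/eqP eA eB].
have BUA : parts_in (U :\: A) B.
  apply/andP; split=> //; apply/allP => C CB; rewrite subsetD (allP BU) //=.
  by rewrite disjoint_sym (allP AB).
have := IHB _ BUA eB; rewrite -(cardsID A (e :&: U)).
have -> : e :&: U :&: A = e :&: A by rewrite -setIA (setIidPr AU).
by rewrite eA setIDA add1n ltnS.
Qed.

Lemma edge_of_setI U B e : parts_in U B ->
  edge_of B (e :&: U) = (#|e :&: U| == size B) && all (fun A => #|e :&: A| == 1) B.
Proof.
move=> /andP[BU _]; rewrite /edge_of; congr andb; apply: eq_in_all => A /(allP BU) AU.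
by rewrite -setIA (setIidPr AU).
Qed.

(** By [size_parts_le] e has at least [size B] points in U and at least [size C]
    points in W; having [size B + size C] points in all, it has exactly these. *)
Lemma edge_of_cat U W B C e : [disjoint U & W] -> parts_in U B -> parts_in W C ->
  edge_of (B ++ C) e = [&& edge_of B (e :&: U), edge_of C (e :&: W) & e \subset U :|: W].
Proof.
move=> UW BU CW; rewrite !edge_of_setI // /edge_of size_cat all_cat.
have dUW : #|e :&: (U :|: W)| = #|e :&: U| + #|e :&: W|.
  rewrite setIUr cardsU -setIA [U :&: _]setICA (disjoint_setI0 UW) !setI0 cards0 subn0 //.
have le : #|e :&: (U :|: W)| <= #|e| by rewrite subset_leq_card ?subsetIl.
have subE : (e \subset U :|: W) = (#|e| == #|e :&: (U :|: W)|).
  apply/idP/eqP => [/setIidPl -> //|eX].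
  by apply/setIidPl/eqP; rewrite eqEcard subsetIl eX leqnn.
rewrite subE dUW.
case eB : (all _ B); rewrite /= ?andbF //; case eC : (all _ C); rewrite /= ?andbF ?andbT //.
have := size_parts_le BU eB; have := size_parts_le CW eC; move: le; rewrite dUW.
set a := #|e :&: U|; set b := #|e :&: W|; lia.
Qed.

Lemma parts_in_cat U W B C : [disjoint U & W] -> parts_in U B -> parts_in W C ->
  parts_in (U :|: W) (B ++ C).
Proof.
move=> UW /andP[BU pB] /andP[CW pC]; rewrite /parts_in all_cat pairwise_cat pB pC !andbT -andbA.
apply/and3P; split.
- by apply: sub_all BU => A /subset_trans; apply; apply: subsetUl.
- by apply: sub_all CW => A /subset_trans; apply; apply: subsetUr.
- apply/allrelP => A A' /(allP BU) AU /(allP CW) AW.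
  exact: disjointWl AU (disjointWr AW UW).
Qed.

Lemma decompM U W r s F G k l : [disjoint U & W] ->
  decomp U r F k -> decomp W s G l ->
  decomp (U :|: W) (r + s)
    (fun e => (e \subset U :|: W) * (F (e :&: U) * G (e :&: W))) (k * l).
Proof.
move=> UW [D [sD wfD eD]] [E [sE wfE eE]].
exists (allpairs cat D E); split.
- by rewrite size_allpairs leq_mul.
- apply/allP => _ /allpairsP[[B C] /= [/(allP wfD) + /(allP wfE) + ->]].
  move=> /andP[/eqP <- BU] /andP[/eqP <- CW]; rewrite size_cat eqxx /=.
  exact: parts_in_cat.
move=> e; rewrite big_allpairs_dep /= -eD -eE big_distrl big_distrr /=.
rewrite big_seq [RHS]big_seq; apply: eq_bigr => B /(allP wfD) /andP[_ BU].
rewrite !big_distrr /= big_seq [RHS]big_seq; apply: eq_bigr => C /(allP wfE) /andP[_ CW].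
rewrite (edge_of_cat _ UW BU CW).
by case: (edge_of B _); case: (edge_of C _); case: (_ \subset _).
Qed.

End Blocks.

(** A profile prescribes how many points a set has in each of several disjoint
    vertex sets, and excludes points elsewhere. *)
Section Profiles.

Variable T : finType.
Implicit Types (e : {set T}) (s : seq ({set T} * nat)).

Definition ground s := \bigcup_(p <- s) p.1.
Definition weight s := \sum_(p <- s) p.2.
Definition profile s e := (e \subset ground s) && all (fun p => #|e :&: p.1| == p.2) s.
Definition profile_decomp s k := decomp (ground s) (weight s) (fun e => profile s e) k.

Definition disjoint_parts s :=
  pairwise (fun p q : {set T} * nat => [disjoint p.1 & q.1]) s.

Lemma ground_cat s s' : ground (s ++ s') = ground s :|: ground s'.
Proof. by rewrite /ground big_cat. Qed.

Lemma ground_cons p s : ground (p :: s) = p.1 :|: ground s.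
Proof. by rewrite /ground big_cons. Qed.

Lemma ground1 p : ground [:: p] = p.1.
Proof. by rewrite /ground big_seq1. Qed.

Lemma sub_ground p s : p \in s -> p.1 \subset ground s.
Proof.
elim: s => //= q s IHs; rewrite inE ground_cons => /orP[/eqP->|/IHs ps]; first exact: subsetUl.
exact: subset_trans ps (subsetUr _ _).
Qed.

Lemma disjoint_ground (U : {set T}) s :
  [disjoint U & ground s] = all (fun p : {set T} * nat => [disjoint U & p.1]) s.
Proof.
elim: s => [|p s IHs] /=; first by rewrite /ground big_nil -setI_eq0 setI0 eqxx.
rewrite ground_cons -IHs -!setI_eq0 setIUr setU_eq0 //.
Qed.

Lemma profile_setI (U : {set T}) s e :
  ground s \subset U -> all (fun p => #|e :&: U :&: p.1| == p.2) s
  = all (fun p => #|e :&: p.1| == p.2) s.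
Proof.
move=> sU; apply: eq_in_all => p ps.
by rewrite -setIA (setIidPr (subset_trans (sub_ground ps) sU)).
Qed.

Lemma profile_decomp_cat s s' k l : [disjoint ground s & ground s'] ->
  profile_decomp s k -> profile_decomp s' l -> profile_decomp (s ++ s') (k * l).
Proof.
move=> dss' cs cs'; have := decompM dss' cs cs'.
rewrite /profile_decomp -ground_cat /weight big_cat /=; apply: decomp_ext => e.
rewrite /profile !subsetIr !profile_setI // all_cat.
by case: (_ \subset _); case: all; case: all.
Qed.

Lemma profile_decomp_le s k l : k <= l -> profile_decomp s k -> profile_decomp s l.
Proof. exact: decomp_le. Qed.

Lemma profile_decomp_nil : profile_decomp [::] 1.
Proof.
rewrite /profile_decomp; exists [:: [::]]; split=> // [|e]; first by rewrite /weight big_nil.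
by rewrite big_seq1 /edge_of /profile /ground big_nil subset0 cards_eq0 !andbT.
Qed.

Lemma profile_decomp_single (U : {set T}) : profile_decomp [:: (U, 1)] 1.
Proof.
exists [:: [:: U]]; split=> //=.
  by rewrite /weight big_seq1 /parts_in ground1 /= subxx.
move=> e; rewrite big_seq1 /edge_of /profile ground1 /= !andbT; congr nat_of_bool.
have [/eqP eU|] := boolP (#|e :&: U| == 1); last by rewrite !andbF.
rewrite !andbT; apply/eqP/idP => [e1|/setIidPl <- //].
by apply/setIidPl/eqP; rewrite eqEcard subsetIl eU e1.
Qed.

Lemma profile_decomp_0 (U : {set T}) : profile_decomp [:: (U, 0)] 1.
Proof.
apply: decomp_sub (sub0set _) _.
have := profile_decomp_nil; rewrite /profile_decomp /weight /ground !big_nil big_seq1.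
apply: decomp_ext => e; rewrite /profile /ground big_nil big_seq1 /= !andbT.
rewrite cards_eq0 subset0; congr nat_of_bool.
apply/eqP/andP => [->|[/setIidPl -> /eqP //]]; first by rewrite sub0set set0I.
Qed.

Lemma profile_perm s s' : perm_eq s s' -> profile s =1 profile s'.
Proof.
move=> ss' e; rewrite /profile /ground (perm_big _ ss') /=; congr andb.
exact: perm_all.
Qed.

End Profiles.

Section Layers.

Variable n : nat.
Implicit Types (e U : {set 'I_n}) (y : 'I_n).

Definition above y : {set 'I_n} := [set z : 'I_n | y < z].
Definition below y : {set 'I_n} := [set z : 'I_n | z < y].

(** The points of e have pairwise distinct numbers of larger points in e, so these
    numbers are 0, ..., [#|e| - 1], each taken once. *)
Lemma sum_card_above e k : k < #|e| -> \sum_(y in e) (#|e :&: above y| == k) = 1.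
Proof.
move=> ke; pose g y := #|e :&: above y|.
have g_lt y z : y \in e -> z \in e -> y < z -> g z < g y.
  move=> ye ze yz; apply: proper_card; apply/properP; split.
    by apply: setIS; apply/subsetP => x; rewrite !inE; apply: ltn_trans.
  by exists z; rewrite !inE ?ze //= ltnn.
have g_inj : {in e &, injective g}.
  move=> y z ye ze gyz; apply: val_inj; case: (ltngtP (val y) (val z)) => // yz.
    by have := g_lt _ _ ye ze yz; rewrite gyz ltnn.
  by have := g_lt _ _ ze ye yz; rewrite gyz ltnn.
have g_le y : y \in e -> g y < #|e|.
  move=> ye; apply: proper_card; apply/properP; split; first exact: subsetIl.
  by exists y => //; rewrite !inE ltnn andbF.
pose s := [seq g y | y <- enum e].
have us : uniq s by rewrite map_inj_in_uniq ?enum_uniq // => y z; rewrite !mem_enum; apply: g_inj.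
have sub : {subset s <= iota 0 #|e|}.
  by move=> _ /mapP[y ye ->]; rewrite mem_iota /= g_le //; rewrite mem_enum in ye.
have szs : size (iota 0 #|e|) <= size s by rewrite size_iota size_map -cardE.
have [_ eqs] := uniq_min_size us sub szs.
transitivity (count_mem k s); last first.
  by rewrite count_uniq_mem // eqs mem_iota ke.
by rewrite -big_enum -sum1_count big_map [RHS]big_mkcond.
Qed.

(** Fix the second largest point y of the set: the largest point is free above y and
    the remaining ones form a set below y, of size smaller by two. *)
Lemma profile_decomp_layer U j : profile_decomp [:: (U, j)] (#|U| ^ j./2).
Proof.
have [m] := ubnP j; elim: m => // m IHm in U j *; case: j => [|[|j]] jm.
- exact: profile_decomp_0.
- exact: profile_decomp_single.
pose s y := [:: ([set y], 1); (U :&: above y, 1); (U :&: below y, j)].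
have cs y : y \in U -> profile_decomp (s y) (#|U| ^ j./2).
  move=> yU; have cB := IHm (U :&: below y) j (ltnW jm).
  have cA := profile_decomp_single (U :&: above y).
  have c1 := profile_decomp_single [set y].
  apply: profile_decomp_le (profile_decomp_cat _ c1 (profile_decomp_cat _ cA cB));
    rewrite ?ground1 /=.
  - by rewrite !mul1n; case: (j./2) => // i; rewrite leq_exp2r ?subset_leq_card ?subsetIl.
  - rewrite ground_cons ground1 disjoints1 !inE ltnn andbF //.
  - by rewrite -setI_eq0; apply/eqP/setP=> z; rewrite !inE; case: ltngtP => //; rewrite ?andbF.
have gs y : y \in U -> ground (s y) = U.
  move=> yU; rewrite !ground_cons /ground big_nil setU0 /=; apply/setP => z; rewrite !inE.
  have [->|zy] := eqVneq z y; first by rewrite yU.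
  by move: zy; rewrite -val_eqE /= -andb_orr; case: ltngtP; rewrite ?andbT.
have ws y : weight (s y) = j.+2 by rewrite /weight !big_cons big_nil /= addn0 !add1n.
have := decomp_sum (index_enum 'I_n) (P := mem U) (U := U) (r := j.+2)
  (F := fun y e => profile (s y) e : nat) (c := fun=> #|U| ^ j./2).
have -> : \sum_(y in U) #|U| ^ j./2 = #|U| ^ j.+2./2 by rewrite sum_nat_const -expnS.
rewrite /profile_decomp ground1 /weight big_seq1 /= => H; apply: decomp_ext (H _); last first.
  by move=> y yU; have := cs y yU; rewrite /profile_decomp gs // ws.
move=> e.
have profE y : y \in U ->
    profile (s y) e = [&& e \subset U, #|e| == j.+2, y \in e & #|e :&: above y| == 1].
  move=> yU; rewrite /profile gs //; case eU: (e \subset U) => //=.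
  rewrite !andbT !setIA (setIidPl eU).
  have -> : (#|e :&: [set y]| == 1) = (y \in e).
    by rewrite setIC; have [ye|ye] := boolP (y \in e);
       [rewrite (setIidPl _) ?sub1set // cards1|rewrite (disjoint_setI0 _) ?disjoints1 // cards0].
  have ce : #|e| = #|e :&: above y| + (#|e :&: [set y]| + #|e :&: below y|).
    rewrite -(cardsID (above y) e); congr addn; rewrite -(cardsID [set y] (_ :\: _)).
    congr (_ + _); apply: eq_card => z; rewrite !inE.
      by have [->|] := eqVneq z y; rewrite ?ltnn ?andbT ?andbF.
    by rewrite -val_eqE /=; case: ltngtP; rewrite ?andbF ?andbT.
  case ye: (y \in e); rewrite ?andbF //=; case: eqP; rewrite ?andbF ?andbT //= => e1.
  rewrite ce e1; have -> : #|e :&: [set y]| = 1.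
    by rewrite (setIidPr _) ?cards1 ?sub1set.
  by rewrite !add1n !eqSS.
rewrite (eq_bigr _ (fun y yU => congr1 nat_of_bool (profE y yU))).
rewrite /profile ground1 /= andbT; have [eU|] := boolP (e \subset U); last by rewrite big1.
rewrite (setIidPl eU) /=; have [/eqP ej|] := boolP (#|e| == j.+2); last by rewrite big1.
rewrite /= (bigID (mem e)) /= [X in _ + X]big1 => [|y /andP[_ /negPf ->]] //.
rewrite addn0 (eq_bigl (mem e)) => [|y]; last first.
  by case ye: (y \in e); rewrite ?andbF // (subsetP eU).
rewrite (eq_bigr (fun y => (#|e :&: above y| == 1) : nat)); first by rewrite sum_card_above ?ej.
by move=> y ye; have -> : y \in e by exact: ye.
Qed.

End Layers.

(** * Pairs of edges of complete graphs *)

Section Pairs.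

(** Let M1 = {01, 23}, M2 = {02, 13}, M3 = {03, 12} be the perfect matchings of
    K_4, and colour the edges of K_6 by
    H0 = {03, 14}, H1 = {04, 13, 23, 24}, H2 = {01, 05, 34, 45} and
    H3 = {02, 12, 15, 25, 35}.  For an edge f in Hi with i > 0, split K_4 into the
    4-cycle avoiding Mi and the two edges of Mi; for f in H0, split K_4 into its six
    edges.  Then the 4-cycle avoiding Mi goes with Hi, and each edge of Mi goes with
    the union of H0 and Hi.  The gain comes from H0 completing bipartite graphs:
    each Hi needs two complete bipartite graphs (first list), whereas the union of
    H0 and Hi needs only one for i = 1, 2 and two for i = 3 (second list), which
    makes 6 + 2 (1 + 1 + 2) = 14. *)
Definition product_table : seq (seq nat * seq nat * (seq nat * seq nat)) :=
  let C := [:: (([:: 0; 1], [:: 2; 3]), ([:: 0; 2], [:: 4]));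
               (([:: 0; 1], [:: 2; 3]), ([:: 1; 2], [:: 3]));
               (([:: 0; 2], [:: 1; 3]), ([:: 0], [:: 1; 5]));
               (([:: 0; 2], [:: 1; 3]), ([:: 4], [:: 3; 5]));
               (([:: 0; 3], [:: 1; 2]), ([:: 2], [:: 0; 1; 5]));
               (([:: 0; 3], [:: 1; 2]), ([:: 5], [:: 1; 3]))] in
  C ++ [:: (([:: 0], [:: 1]), ([:: 0; 1; 2], [:: 3; 4]));
           (([:: 2], [:: 3]), ([:: 0; 1; 2], [:: 3; 4]));
           (([:: 0], [:: 2]), ([:: 0; 4], [:: 1; 3; 5]));
           (([:: 1], [:: 3]), ([:: 0; 4], [:: 1; 3; 5]));
           (([:: 0], [:: 3]), ([:: 0; 5], [:: 2; 3]));
           (([:: 1], [:: 2]), ([:: 0; 5], [:: 2; 3]));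
           (([:: 0], [:: 3]), ([:: 1], [:: 2; 4; 5]));
           (([:: 1], [:: 2]), ([:: 1], [:: 2; 4; 5]))].

(** For disjoint P.1 and P.2: i and j lie one in P.1 and the other in P.2. *)
Definition crosses (P : seq nat * seq nat) (i j : nat) :=
  ((i \in P.1) + (j \in P.1) == 1) && ((i \in P.2) + (j \in P.2) == 1).

(** Adjacency in the complete graph on 0, ..., m; the label m + 1 stands for a point
    outside the blow-up. *)
Definition joined m i j := [&& i != j, i <= m & j <= m].

Lemma sum_nat_bool (I : Type) (s : seq I) (a : pred I) : \sum_(i <- s) a i = count a s.
Proof. by rewrite -sum1_count [RHS]big_mkcond. Qed.

Lemma product_tableP i j k l : i <= 4 -> j <= 4 -> k <= 6 -> l <= 6 ->
  \sum_(t <- product_table) (crosses t.1 i j && crosses t.2 k l)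
  = joined 3 i j && joined 5 k l.
Proof.
have H : all (fun i => all (fun j => all (fun k => all (fun l =>
    count (fun t => crosses t.1 i j && crosses t.2 k l) product_table
      == (joined 3 i j && joined 5 k l))
    (iota 0 7)) (iota 0 7)) (iota 0 5)) (iota 0 5) by vm_compute.
move=> i4 j4 k6 l6; rewrite sum_nat_bool; apply/eqP.
have mem_le a b : a <= b -> a \in iota 0 b.+1 by rewrite mem_iota.
by move/allP/(_ i (mem_le _ _ i4))/allP/(_ j (mem_le _ _ j4))/allP/(_ k (mem_le _ _ k6))
  /allP/(_ l (mem_le _ _ l6)): H.
Qed.

(** The a-th blow-up of [K_(m+1)] in the complete graph on 0, ..., m k: the points up
    to m a form one class, each of the next m points is a class of its own, and later
    points are left out. *)
Definition node_label m a p := minn (p - m * a) m.+1.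

(** For p < q, the blow-up containing the edge pq is the one in which q is one of the
    m single points, i.e. m a < q <= m (a + 1). *)
Lemma sum_node_label m k p q : 0 < m -> p != q -> p <= m * k -> q <= m * k ->
  \sum_(a < k) joined m (node_label m a p) (node_label m a q) = 1.
Proof.
move=> m0; wlog pq : p q / p < q => [H|_ _ qk].
  case: (ltngtP p q) => // pq _ pk qk; first by apply: H; rewrite ?(ltn_eqF pq).
  rewrite -(H q p) ?(ltn_eqF pq) //; apply: eq_bigr => a _.
  by rewrite /joined eq_sym [X in _ && X]andbC.
have joinedE a : joined m (node_label m a p) (node_label m a q) = (a == q.-1 %/ m).
  have := divn_eq q.-1 m; have := ltn_pmod q.-1 m0.
  rewrite /joined /node_label; set d := q.-1 %/ m; set r := _ %% m => rm qE.
  have qE' : q = d * m + r + 1 by lia.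
  case: (ltngtP a d) => [ad|da|->].
  - have : m * a.+1 <= m * d by rewrite leq_mul2l ad orbT.
    rewrite mulnS => ?; apply/negbTE/negP; case/and3P => _ _; lia.
  - have : m * d.+1 <= m * a by rewrite leq_mul2l da orbT.
    rewrite mulnS => ?; apply/negbTE/negP; case/and3P => /eqP; lia.
  - apply/and3P; split; lia.
have dk : q.-1 %/ m < k.
  by rewrite ltn_divLR // mulnC; case: q pq qk {joinedE} => // q _; exact.
rewrite (bigD1 (Ordinal dk)) //= joinedE eqxx big1 // => a.
by rewrite -val_eqE /= joinedE => /negPf ->.
Qed.

Variable T : finType.
Implicit Types (e U V W : {set T}).

Definition label U m a x := node_label m a (index x (enum U)).
Definition label_class U m a (A : seq nat) : {set T} := [set x in U | label U m a x \in A].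
Definition label_pair U m a (P : seq nat * seq nat) :=
  [:: label_class U m a P.1; label_class U m a P.2].

Lemma label_pair_parts U m a P : ~~ has [in P.1] P.2 -> parts_in U (label_pair U m a P).
Proof.
move=> P12; rewrite /parts_in /= !andbT -andbA; apply/and3P; split.
- by apply/subsetP => x; rewrite inE => /andP[].
- by apply/subsetP => x; rewrite inE => /andP[].
rewrite -setI_eq0; apply/eqP/setP => x; rewrite !inE.
apply/negbTE/negP => /andP[/andP[_ x1] /andP[_ x2]].
by move/hasPn/(_ _ x2): P12; rewrite /= x1.
Qed.

Lemma edge_label_pair U m a P x y : x \in U -> y \in U -> x != y ->
  edge_of (label_pair U m a P) [set x; y] = crosses P (label U m a x) (label U m a y).
Proof.
move=> xU yU xy; rewrite /edge_of /= cards2 xy /= andbT /crosses.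
have cE A : #|[set x; y] :&: label_class U m a A|
    = (label U m a x \in A) + (label U m a y \in A).
  rewrite setIUl cardsU.
  have -> : [set x] :&: label_class U m a A :&: ([set y] :&: label_class U m a A) = set0.
    apply/setP => z; rewrite !inE; apply/negbTE/negP => /andP[/andP[/eqP -> _]].
    by rewrite (negPf xy).
  have c1 z : z \in U -> #|[set z] :&: label_class U m a A| = (label U m a z \in A).
    move=> zU; case zA : (label U m a z \in A).
      by rewrite (setIidPl _) ?cards1 // sub1set inE zU.
    by rewrite (disjoint_setI0 _) ?cards0 // disjoints1 inE zU zA.
  by rewrite !c1 // cards0 subn0.
by rewrite !cE.
Qed.

Lemma label_le U m a x : label U m a x <= m.+1.
Proof. exact: geq_minr. Qed.

Lemma sum_label U m k x y : 0 < m -> #|U| <= (m * k).+1 -> x \in U -> y \in U -> x != y ->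
  \sum_(a < k) joined m (label U m a x) (label U m a y) = 1.
Proof.
move=> m0 Uk xU yU xy; apply: sum_node_label => //.
- by apply: contra xy => /eqP /(index_inj _) ->; rewrite ?mem_enum.
- by rewrite -ltnS (leq_trans _ Uk) // cardE index_mem mem_enum.
- by rewrite -ltnS (leq_trans _ Uk) // cardE index_mem mem_enum.
Qed.

(** On 15 k + 1 points there are 5 k blow-ups of K_4 or 3 k blow-ups of K_6, and each
    pair of blow-ups takes 14 blocks: 5 k * 3 k * 14 = 210 k ^ 2. *)
Lemma profile_decomp_pair V W k : [disjoint V & W] ->
  #|V| <= (15 * k).+1 -> #|W| <= (15 * k).+1 -> profile_decomp [:: (V, 2); (W, 2)] (210 * k ^ 2).
Proof.
move=> dVW Vk Wk.
pose block a b (t : _ * _) := label_pair V 3 a t.1 ++ label_pair W 5 b t.2.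
have tabP : all (fun t : _ * _ => ~~ has [in t.1.1] t.1.2 && ~~ has [in t.2.1] t.2.2)
  product_table by [].
have partsV a t : t \in product_table -> parts_in V (label_pair V 3 a t.1).
  by move=> /(allP tabP) /andP[? _]; apply: label_pair_parts.
have partsW b t : t \in product_table -> parts_in W (label_pair W 5 b t.2).
  by move=> /(allP tabP) /andP[_ ?]; apply: label_pair_parts.
have D : decomp (V :|: W) 4
    (fun e => \sum_(a < 5 * k) \sum_(b < 3 * k) \sum_(t <- product_table | t \in product_table)
       edge_of (block a b t) e)
    (\sum_(a < 5 * k) \sum_(b < 3 * k) \sum_(t <- product_table | t \in product_table) 1).
  do 2![apply: decomp_sum => ? _]; apply: decomp_sum => t tT.
  by apply: (@decomp_block T (V :|: W) (block _ _ t)); apply: parts_in_cat; auto.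
have E : \sum_(a < 5 * k) \sum_(b < 3 * k) \sum_(t <- product_table | t \in product_table) 1
    = 210 * k ^ 2.
  rewrite -big_seq sum1_size !sum_nat_const !card_ord (_ : size product_table = 14) // -mulnn; nia.
rewrite -E; have gE : ground [:: (V, 2); (W, 2)] = V :|: W by rewrite ground_cons ground1.
rewrite /profile_decomp gE /weight big_cons big_seq1; apply: decomp_ext D => e.
rewrite /profile gE /= andbT.
have blockE a b t : t \in product_table -> edge_of (block a b t) e =
    [&& edge_of (label_pair V 3 a t.1) (e :&: V), edge_of (label_pair W 5 b t.2) (e :&: W)
      & e \subset V :|: W].
  by move=> tT; rewrite (edge_of_cat _ dVW) ?partsV ?partsW.
have [eVW|eVW] := boolP (e \subset V :|: W); last first.
  rewrite big1 // => a _; rewrite big1 // => b _; rewrite big1 // => t tT.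
  by rewrite blockE // (negPf eVW) !andbF.
have [/cards2P[x [y [xy eV]]]|eV] := boolP (#|e :&: V| == 2); last first.
  rewrite big1 // => a _; rewrite big1 // => b _; rewrite big1 // => t tT.
  by rewrite blockE // /edge_of (negPf eV).
have [/cards2P[z [w [zw eW]]]|eW] := boolP (#|e :&: W| == 2); last first.
  rewrite big1 // => a _; rewrite big1 // => b _; rewrite big1 // => t tT.
  by rewrite blockE // [X in _ && (X && _)]/edge_of (negPf eW) andbF.
have inV u : u \in [set x; y] -> u \in V by rewrite -eV inE => /andP[].
have inW u : u \in [set z; w] -> u \in W by rewrite -eW inE => /andP[].
have [xV yV] : x \in V /\ y \in V by split; apply: inV; rewrite !inE eqxx ?orbT.
have [zW wW] : z \in W /\ w \in W by split; apply: inW; rewrite !inE eqxx ?orbT.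
transitivity (\sum_(a < 5 * k) joined 3 (label V 3 a x) (label V 3 a y)
    * \sum_(b < 3 * k) joined 5 (label W 5 b z) (label W 5 b w)); last first.
  rewrite (sum_label (k := 3 * k)) ?mulnA // -big_distrl /=.
  by rewrite (sum_label (k := 5 * k)) ?mulnA.
apply: eq_bigr => a _; rewrite big_distrr /=; apply: eq_bigr => b _.
rewrite mulnb -product_tableP ?label_le // [RHS]big_seq.
apply: eq_bigr => t tT.
by rewrite blockE // eVW andbT eV eW !edge_label_pair.
Qed.

End Pairs.

(** * Costs of profiles *)

Section Mixed.

Variable n : nat.
Implicit Types (s : seq ({set 'I_n} * nat)).

(** The cost of two points in each of j cells: the cells are grouped two by two, with
    one left over when j is odd. *)
Definition pair_cost k j := (210 * k ^ 2) ^ j./2 * (15 * k).+1 ^ odd j.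

Lemma profile_decomp_perm s s' k : perm_eq s s' -> profile_decomp s k -> profile_decomp s' k.
Proof.
move=> ss'; rewrite /profile_decomp /ground /weight !(perm_big _ ss') /=.
by apply: decomp_ext => e; rewrite (profile_perm ss').
Qed.

Lemma disjoint_partsP s p q :
  disjoint_parts s -> p \in s -> q \in s -> p != q -> [disjoint p.1 & q.1].
Proof.
elim: s => // a s IHs; rewrite /disjoint_parts /= !inE => /andP[/allP da ds].
case/predU1P=> [->|ps] /predU1P[->|qs] pq; rewrite ?eqxx // in pq *.
- exact: da.
- by rewrite disjoint_sym; apply: da.
- exact: IHs.
Qed.

Lemma profile_decomp_part L (U : {set 'I_n}) j :
  #|U| <= L -> profile_decomp [:: (U, j)] (L ^ j./2).
Proof.
move=> UL; apply: profile_decomp_le (profile_decomp_layer U j).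
by case: j./2 => // h; rewrite leq_exp2r.
Qed.

Lemma profile_decomp_all L s : disjoint_parts s ->
  all (fun p : {set 'I_n} * nat => #|p.1| <= L) s ->
  profile_decomp s (L ^ \sum_(p <- s) p.2./2).
Proof.
elim: s => [|[U j] s IHs] /=; first by rewrite big_nil => _ _; apply: profile_decomp_nil.
rewrite /disjoint_parts /= => /andP[dU ds] /andP[UL sL].
rewrite big_cons expnD /=; apply: (@profile_decomp_cat _ [:: (U, j)]); last exact: IHs.
  by rewrite ground1 disjoint_ground.
exact: profile_decomp_part.
Qed.

Lemma profile_decomp_twos k s : disjoint_parts s -> all (fun p => p.2 == 2) s ->
  all (fun p : {set 'I_n} * nat => #|p.1| <= (15 * k).+1) s ->
  profile_decomp s (pair_cost k (size s)).
Proof.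
have [l] := ubnP (size s); elim: l s => // l IHl [|[V v] [|[W w] s]] sl.
- by move=> _ _ _; rewrite /pair_cost /= mul1n; apply: profile_decomp_nil.
- move=> _ /= /andP[/eqP -> _] /andP[Vk _]; rewrite /pair_cost /= mul1n.
  exact: profile_decomp_part.
rewrite /disjoint_parts /= => /andP[/andP[VW dV] /andP[dW ds]].
move=> /and3P[/eqP -> /eqP -> s2] /and3P[Vk Wk sk].
have -> : pair_cost k (size s).+2 = (210 * k ^ 2) * pair_cost k (size s).
  by rewrite /pair_cost /= negbK expnS mulnA.
apply: (@profile_decomp_cat _ [:: (V, 2); (W, 2)]).
- rewrite ground_cons ground1 /= -setI_eq0 setIUl setU_eq0 !setI_eq0.
  by rewrite !disjoint_ground dV dW.
- exact: profile_decomp_pair.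
- by apply: IHl => //; move: sl; rewrite /= !ltnS => /ltnW.
Qed.

Lemma profile_decomp_mixed k s : disjoint_parts s ->
  all (fun p : {set 'I_n} * nat => #|p.1| <= (15 * k).+1) s ->
  profile_decomp s (pair_cost k (count (fun p => p.2 == 2) s)
           * (15 * k).+1 ^ \sum_(p <- s | p.2 != 2) p.2./2).
Proof.
move=> ds sk; set two := fun p => p.2 == 2.
have perm_s : perm_eq (filter two s ++ filter (predC two) s) s by rewrite perm_filterC.
apply: profile_decomp_perm perm_s _; rewrite -size_filter -[X in _ ^ X]big_filter.
apply: profile_decomp_cat.
- rewrite disjoint_sym disjoint_ground; apply/allP => p; rewrite mem_filter => /andP[/= p2 ps].
  rewrite disjoint_sym disjoint_ground; apply/allP => q; rewrite mem_filter => /andP[/= q2 qs].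
  have pq : p != q by apply: contraNneq q2 => <-.
  exact: disjoint_partsP ps qs pq.
- apply: profile_decomp_twos; first exact: pairwise_filter.
    by apply: filter_all.
  by rewrite all_filter; apply: sub_all sk => p pk; apply/implyP.
- apply: profile_decomp_all; first exact: pairwise_filter.
  by rewrite all_filter; apply: sub_all sk => p pk; apply/implyP.
Qed.

End Mixed.

Section Upper.

(** Since every r-set is an edge of exactly one block of the list, dropping the blocks
    without edges leaves distinct edge sets, with nonempty classes. *)
Lemma f_le r n k :
  decomp [set: 'I_n] r (fun e : {set 'I_n} => #|e| == r : nat) k -> f_ r n <= k.
Proof.
move=> [D [sD wfD eD]]; pose edges B : {set {set 'I_n}} := [set e | edge_of B e].
pose P := [set H in [seq edges B | B <- D] | H != set0].
have sP : #|P| <= k.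
  apply: leq_trans sD; rewrite -(size_map edges D).
  apply: leq_trans (card_size _); apply: subset_leq_card.
  by apply/subsetP => H; rewrite inE => /andP[].
rewrite /f_; case: ex_minnP => l _ min_l; apply: leq_trans sP; apply: min_l.
apply/existsP; exists P; rewrite eqxx andbT.
have edge_uniq B C e : B \in D -> C \in D -> edge_of B e -> edge_of C e -> B = C.
  move=> BD CD eB eC; apply/eqP; apply: contraT => BC.
  have := eD e; rewrite (big_rem B BD) /= (big_rem C) /=; last first.
    by move: CD; rewrite (perm_mem (perm_to_rem BD)) inE eq_sym (negPf BC).
  by rewrite eB eC; case: (#|e| == r); lia.
apply/andP; split.
  apply/and3P; split.
  - apply/eqP/setP => e; rewrite inE; apply/bigcupP/idP => [[H]|er].
      rewrite inE => /andP[/mapP[B BD ->] _]; rewrite inE => eB.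
      have := eD e; rewrite (big_rem B BD) /= eB.
      by case: (#|e| == r) => //; lia.
    have : \sum_(B <- D) edge_of B e != 0 by rewrite eD er.
    rewrite sum_nat_seq_neq0 => /hasP[B BD /= eB].
    have {}eB : edge_of B e by move: eB; case: edge_of.
    exists (edges B); rewrite !inE // map_f //=.
    by apply/set0Pn; exists e; rewrite inE.
  - apply/trivIsetP => H H'; rewrite !inE => /andP[/mapP[B BD ->] _] /andP[/mapP[C CD ->] _].
    move=> BC; rewrite -setI_eq0; apply/eqP/setP => e; rewrite !inE.
    apply/negbTE/negP => /andP[eB eC].
    by rewrite (edge_uniq B C e) ?eqxx in BC.
  - by rewrite inE eqxx andbF.
apply/forallP => H; apply/implyP; rewrite inE => /andP[/mapP[B BD ->]] /set0Pn[e0].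
rewrite inE => /andP[_ eB0].
have /andP[/eqP sB /andP[_ dB]] := allP wfD _ BD.
have nthB (i : 'I_r) : nth set0 B i \in B by rewrite mem_nth // sB.
apply/existsP; exists [ffun i : 'I_r => nth set0 B i]; apply/and3P; split.
- apply/forallP => i; rewrite ffunE; apply: contraTneq (allP eB0 _ (nthB i)) => ->.
  by rewrite setI0 cards0.
- apply/forallP => i; apply/forallP => j; apply/implyP => ij; rewrite !ffunE.
  wlog lt_ij : i j ij / i < j => [W|].
    case: (ltngtP i j) => [|ji|/val_inj eij]; first exact: W.
      by rewrite disjoint_sym W // eq_sym.
    by rewrite eij eqxx in ij.
  by move/(pairwiseP set0): dB => /(_ i j); rewrite !inE sB => ->.
apply/eqP/setP => e; rewrite !inE /edge_of sB; congr andb; apply/allP/forallP => [eB i|eB A].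
  by rewrite ffunE; apply: eB.
by move=> /(nthP set0)[i]; rewrite sB => ir <-; have := eB (Ordinal ir); rewrite ffunE.
Qed.

End Upper.

(** * Sorting the sets by type *)

Section Types.

Variables (n m d k : nat) (piece : 'I_n -> 'I_m).
Hypothesis piece_le : forall i, #|[set x | piece x == i]| <= (15 * k).+1.

Variable r : nat.
Hypothesis rE : r = d.*2.+1.
Local Notation typ := {ffun 'I_m -> 'I_r.+1}.
Implicit Types (e : {set 'I_n}) (I : {set 'I_m}) (u t : typ).

Definition cell i : {set 'I_n} := [set x | piece x == i].
Definition cells I (f : 'I_m -> nat) := [seq (cell i, f i) | i <- enum I].

Lemma ground_cells I f : ground (cells I f) = [set x | piece x \in I].
Proof.
rewrite /ground big_map big_enum /=; apply/setP => x; rewrite inE.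
apply/bigcupP/idP => [[i iI]|xI]; first by rewrite inE => /eqP ->.
by exists (piece x); rewrite // inE.
Qed.

Lemma disjoint_cells I f : disjoint_parts (cells I f).
Proof.
have := enum_uniq I; rewrite uniq_pairwise /disjoint_parts pairwise_map.
apply: sub_pairwise => i j /= ij; rewrite -setI_eq0; apply/eqP/setP => x; rewrite !inE.
by apply/negbTE/negP => /andP[/eqP -> /eqP ji]; rewrite ji eqxx in ij.
Qed.

Lemma weight_cells I f : weight (cells I f) = \sum_(i in I) f i.
Proof. by rewrite /weight big_map big_enum. Qed.

Lemma profile_cells I f e : profile (cells I f) e =
  (e \subset [set x | piece x \in I]) && [forall (i | i \in I), #|e :&: cell i| == f i].
Proof.
rewrite /profile ground_cells; congr andb; rewrite all_map.
apply/allP/forall_inP => H i iI; first by apply: (H i); rewrite mem_enum.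
by apply: H; rewrite mem_enum in iI.
Qed.

Lemma card_cells e I : #|e :&: [set x | piece x \in I]| = \sum_(i in I) #|e :&: cell i|.
Proof.
rewrite -sum1_card (partition_big piece (mem I)) /=; last first.
  by move=> x; rewrite !inE => /andP[].
apply: eq_bigr => i iI; rewrite -sum1_card; apply: eq_bigl => x; rewrite !inE.
by case: eqP => [->|]; rewrite ?iI ?andbT ?andbF.
Qed.

Lemma small_cells I f :
  all (fun p : {set 'I_n} * nat => #|p.1| <= (15 * k).+1) (cells I f).
Proof. by rewrite all_map; apply/allP => i _; apply: piece_le. Qed.

Lemma profile_decomp_cells I f :
  profile_decomp (cells I f) ((15 * k).+1 ^ \sum_(i in I) (f i)./2).
Proof.
have := profile_decomp_all (disjoint_cells I f) (small_cells I f).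
by rewrite big_map big_enum.
Qed.

Lemma profile_decomp_cells_mixed I f : profile_decomp (cells I f)
  (pair_cost k (\sum_(i in I) (f i == 2)) * (15 * k).+1 ^ \sum_(i in I | f i != 2) (f i)./2).
Proof.
have := profile_decomp_mixed (disjoint_cells I f) (small_cells I f).
by rewrite big_map /= count_map -sum_nat_bool big_enum /= big_enum_cond.
Qed.

Definition halves t := \sum_i (t i)./2.
Definition has_singleton t := [exists i, t i == 1 :> nat].

Definition supp t := [set i | t i != 0 :> nat].
(** u records half the size of the even entries; the remaining point is not
    tied to a cell. *)
Definition singleton_profile u :=
  cells (supp u) (fun i => (u i).*2) ++ [:: ([set x | piece x \in ~: supp u], 1)].
Definition full_profile t := cells setT (fun i => t i : nat).


Lemma profile_full t e : profile (full_profile t) e = [forall i, #|e :&: cell i| == t i].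
Proof.
rewrite profile_cells; have -> : [set x | piece x \in [set: 'I_m]] = setT.
  by apply/setP => x; rewrite !inE.
by rewrite subsetT; apply: eq_forallb => i; rewrite inE.
Qed.

Lemma cells_restI I : [disjoint [set x | piece x \in I] & [set x | piece x \in ~: I]].
Proof. by rewrite -setI_eq0; apply/eqP/setP => x; rewrite !inE andbN. Qed.

Lemma cells_restU I : [set x | piece x \in I] :|: [set x | piece x \in ~: I] = setT.
Proof. by apply/setP => x; rewrite !inE orbN. Qed.

Lemma profile_singleton u e : profile (singleton_profile u) e =
  [forall (i | i \in supp u), #|e :&: cell i| == (u i).*2]
  && (\sum_(i in ~: supp u) #|e :&: cell i| == 1).
Proof.
rewrite /profile ground_cat ground_cells ground1 cells_restU subsetT all_cat /= andbT.
rewrite card_cells; congr andb; rewrite all_map.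
apply/allP/forall_inP => H i iI; first by apply: (H i); rewrite mem_enum.
by apply: H; rewrite mem_enum in iI.
Qed.

Lemma card_types e : #|e| = \sum_i #|e :&: cell i|.
Proof.
rewrite -[in LHS](setIT e) (_ : setT = [set x | piece x \in [set: 'I_m]]).
  by rewrite card_cells; apply: eq_bigl => i; rewrite inE.
by apply/setP => x; rewrite !inE.
Qed.

Definition total t := \sum_i (t i : nat).

Lemma total_halves t : total t = (halves t).*2 + \sum_i odd (t i).
Proof.
rewrite /total /halves -muln2 big_distrl -big_split /=; apply: eq_bigr => i _.
by rewrite addnC muln2 odd_double_half.
Qed.

Lemma halves_eq1 t i : total t = r -> halves t = d -> t i = 1 :> nat ->
  forall j, odd (t j) = (j == i).
Proof.
move=> tr hd ti; have : \sum_i odd (t i) = 1.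
  by have := total_halves t; rewrite tr hd; move: (\sum_i _) => z; lia.
rewrite (bigD1 i) //= ti => /eqP; rewrite eqSS sum_nat_eq0 => /forallP H j.
have [->|ji] := eqVneq j i; first by rewrite ti.
by have := H j; rewrite ji /=; case: odd.
Qed.

(** The types covered by a singleton profile. *)
Definition absorbed t := (halves t == d) && has_singleton t.

(** If the type t of e is absorbed, its odd entry is the singleton, and the profile of
    e is the one given by the halves of t.  Conversely a singleton profile
    determines u: the cells outside its support contain at most one point of e. *)
Lemma sum_profiles e :
  \sum_(u : typ | total u == d) profile (singleton_profile u) e +
  \sum_(t : typ | (total t == r) && ~~ absorbed t) profile (full_profile t) e
  = (#|e| == r).
Proof.
have full_r t : profile (full_profile t) e -> total t = #|e|.
  by rewrite profile_full card_types => /forallP H; apply: eq_bigr => i _; rewrite (eqP (H i)).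
have sing_r u : total u = d -> profile (singleton_profile u) e -> #|e| = r.
  move=> ud; rewrite profile_singleton card_types => /andP[/forall_inP H /eqP H1].
  rewrite (bigID (mem (supp u))) /=.
  rewrite [X in _ + X](_ : _ = 1); last by rewrite -H1; apply: eq_bigl => i; rewrite !inE.
  rewrite addn1 (eq_bigr (fun i => u i * 2)) => [|i /H /eqP ->]; last by rewrite muln2.
  rewrite -big_distrl /= muln2; transitivity d.*2.+1; last exact: esym.
  rewrite -ud /total; congr (_.*2.+1).
  rewrite [RHS](bigID (mem (supp u))) /= [X in _ + X]big1 ?addn0 // => i.
  by rewrite inE negbK => /eqP.
have [/eqP er|er] := boolP (#|e| == r); last first.
  rewrite !big1 // => [t /andP[/eqP tr _]|u /eqP ud].
    by apply/eqP; rewrite eqb0; apply: contra er => /full_r <-; rewrite tr.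
  by apply/eqP; rewrite eqb0; apply: contra er => /(sing_r _ ud) ->.
pose t0 : typ := [ffun i => inord #|e :&: cell i|].
have t0E i : t0 i = #|e :&: cell i| :> nat.
  rewrite ffunE inordK // ltnS -er; apply: subset_leq_card; exact: subsetIl.
have full_t0 t : profile (full_profile t) e = (t == t0).
  rewrite profile_full; apply/forallP/eqP => [H|-> i]; last by rewrite t0E.
  by apply/ffunP => i; apply: val_inj; rewrite /= t0E; apply/esym/eqP.
have tot0 : total t0 = r by rewrite -er card_types; apply: eq_bigr => i _; rewrite t0E.
have -> : \sum_(t : typ | (total t == r) && ~~ absorbed t) profile (full_profile t) e
    = ~~ absorbed t0.
  rewrite (eq_bigr _ (fun t _ => congr1 nat_of_bool (full_t0 t))) big_mkcond (bigD1 t0) //=.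
  rewrite tot0 !eqxx big1 => [|t /negPf -> ]; last by case: ifP.
  by case: absorbed.
pose u0 : typ := [ffun i => inord (t0 i)./2].
have u0E i : u0 i = (t0 i)./2 :> nat.
  by rewrite ffunE inordK // ltnS (leq_trans (half_leq (leq_ord _))) // leq_half_double; lia.
have tot_u0 : total u0 = halves t0 by apply: eq_bigr => i _; rewrite u0E.
have sing_u0 u : total u = d ->
    profile (singleton_profile u) e = (u == u0) && absorbed t0.
  move=> ud; apply/idP/andP.
    move=> pu; have := pu; rewrite profile_singleton => /andP[/forall_inP H /eqP H1].
    have uE : u = u0.
      apply/ffunP => i; apply: val_inj; rewrite /= u0E t0E.
      have [iu|iu] := boolP (i \in supp u); first by rewrite (eqP (H i iu)) doubleK.
      have iu' : i \in ~: supp u by rewrite inE.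
      have : #|e :&: cell i| <= 1 by move: H1; rewrite (bigD1 i iu') /=; lia.
      by move: iu; rewrite inE negbK => /eqP ->; case: #|_| => [|[]].
    rewrite uE eqxx /absorbed -tot_u0 -uE ud eqxx; split=> //=.
    apply/existsP; have : \sum_(i in ~: supp u) #|e :&: cell i| != 0 by rewrite H1.
    rewrite sum_nat_eq0 negb_forall => /existsP[i]; rewrite negb_imply => /andP[iu ei].
    exists i; apply/eqP; rewrite t0E.
    by move: H1 ei; rewrite (bigD1 i iu) /=; lia.
  case=> /eqP uE /andP[/eqP h0 /existsP[i /eqP ti]].
  have oddE := halves_eq1 tot0 h0 ti.
  rewrite profile_singleton; apply/andP; split.
    apply/forall_inP => j; rewrite inE uE u0E -t0E => tj.
    have ji : j != i by apply: contraNneq tj => ->; rewrite ti.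
    by rewrite -[X in X == _]odd_double_half oddE (negPf ji).
  have iu : i \in ~: supp u by rewrite !inE uE u0E ti.
  rewrite (bigD1 i) //= -t0E ti big1 // => j /andP[ju ji].
  move: ju; rewrite !inE negbK uE u0E => /eqP tj.
  by rewrite -t0E -[LHS]odd_double_half tj oddE (negPf ji).
rewrite (eq_bigr (fun u => ((u == u0) && absorbed t0) : nat)); last first.
  by move=> u /eqP ud; rewrite sing_u0.
case w0 : (absorbed t0); last by rewrite big1 // => u _; rewrite andbF.
have /andP[/eqP h0 _] := w0.
rewrite (bigD1 u0) /= ?tot_u0 ?h0 // eqxx big1 // => u /andP[_ /negPf -> ] //.
Qed.


Local Notation L := (15 * k).+1.

Definition singleton_cost u :=
  if [forall i, u i <= 1] then pair_cost k d else L ^ d.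

Lemma sum_supp u : \sum_(i in supp u) (u i : nat) = total u.
Proof.
rewrite [RHS](bigID (mem (supp u))) /= [X in _ + X]big1 ?addn0 // => i.
by rewrite inE negbK => /eqP.
Qed.

Lemma decomp_singleton u : total u = d ->
  decomp [set: 'I_n] r (fun e => profile (singleton_profile u) e) (singleton_cost u).
Proof.
move=> ud.
have gE : ground (singleton_profile u) = setT.
  by rewrite ground_cat ground_cells ground1 cells_restU.
have wE : weight (singleton_profile u) = r.
  rewrite /weight big_cat big_seq1 /= -/(weight _) weight_cells.
  under eq_bigr do rewrite -muln2.
  by rewrite -big_distrl /= sum_supp ud muln2 addn1.
suff : profile_decomp (singleton_profile u) (singleton_cost u) by rewrite /profile_decomp gE wE.
rewrite -[singleton_cost u]muln1; apply: profile_decomp_cat; last exact: profile_decomp_single.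
  by rewrite ground_cells ground1 cells_restI.
rewrite /singleton_cost; case: ifP => [/forallP u1|_].
  have uE i : i \in supp u -> u i = 1 :> nat.
    by rewrite inE => ui; have := u1 i; move: ui; case: (u i : nat) => [|[]].
  have := profile_decomp_cells_mixed (supp u) (fun i => (u i).*2).
  have -> : \sum_(i in supp u) ((u i).*2 == 2) = d.
    by rewrite -ud -sum_supp; apply: eq_bigr => i /uE ->.
  by rewrite big1 ?muln1 // => i /andP[/uE -> ].
have := profile_decomp_cells (supp u) (fun i => (u i).*2).
by under eq_bigr do rewrite doubleK; rewrite sum_supp ud.
Qed.

(** If the halves add up to d then, the type not being absorbed, entries at most
    three mean one three and d - 1 twos. *)
Definition full_cost t :=
  if halves t == d then
    if [forall i, t i <= 3] then L * pair_cost k d.-1 else L ^ d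
  else L ^ d.-1.

Lemma halves_le t : total t = r -> halves t <= d.
Proof. by move=> tr; have := total_halves t; rewrite tr; move: (\sum_i _) => z; lia. Qed.

(** The odd entries number r - 2 d = 1. *)
Lemma odd_part t : total t = r -> halves t = d -> exists i, forall j, odd (t j) = (j == i).
Proof.
move=> tr hd; have : \sum_i odd (t i) = 1.
  by have := total_halves t; rewrite tr hd; move: (\sum_i _) => z; lia.
move=> /sum_nat_seq_eq1[i [_ _ oi H]].
exists i => j; have [->|ji] := eqVneq j i; first by case: odd oi.
by have := H j ji (mem_index_enum _) isT; case: odd.
Qed.

Lemma full_part t i : total t = r -> halves t = d -> ~~ absorbed t ->
  (forall j, t j <= 3) -> (forall j, odd (t j) = (j == i)) ->
  (t i = 3 :> nat) /\ (forall j, j != i -> t j = (t j != 0 :> nat).*2 :> nat).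
Proof.
move=> tr hd; rewrite /absorbed hd eqxx /= negb_exists => /forallP t1 t3 oi; split.
  by have := t1 i; have := t3 i; have := oi i; rewrite eqxx; case: (t i : nat) => [|[|[|[|]]]].
move=> j ji; have := oi j; have := t3 j; rewrite (negPf ji).
by case: (t j : nat) => [|[|[|[|]]]].
Qed.

Lemma decomp_full t : 0 < d -> total t = r -> ~~ absorbed t ->
  decomp [set: 'I_n] r (fun e => profile (full_profile t) e) (full_cost t).
Proof.
move=> d0 tr wt.
have gE : ground (full_profile t) = setT.
  by rewrite ground_cells; apply/setP => x; rewrite !inE.
have wE : weight (full_profile t) = r.
  by rewrite weight_cells; apply: etrans tr; apply: eq_bigl => i; rewrite inE.
suff : profile_decomp (full_profile t) (full_cost t) by rewrite /profile_decomp gE wE.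
have hE : \sum_(i in setT) (t i)./2 = halves t by apply: eq_bigl => i; rewrite inE.
have all_cost := profile_decomp_cells setT (fun i => t i : nat); rewrite hE in all_cost.
rewrite /full_cost; case: eqP => [hd|/eqP hd]; last first.
  apply: profile_decomp_le all_cost; apply: leq_pexp2l => //.
  by have := halves_le tr; rewrite leq_eqVlt (negPf hd) /=; case: d d0.
case: ifP => [/forallP t3|_]; last by rewrite -{1}hd.
have [i oi] := odd_part tr hd; have [ti tj] := full_part tr hd wt t3 oi.
have := profile_decomp_cells_mixed setT (fun i => t i : nat).
have -> : \sum_(j in setT | t j != 2 :> nat) (t j)./2 = 1.
  rewrite (bigD1 i) ?inE ?ti //= big1 // => j /andP[/andP[_ j2] /tj tjE].
  by move: j2; rewrite tjE; case: (_ != 0).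
have -> : \sum_(j in setT) (t j == 2 :> nat) = d.-1.
  rewrite -hd /halves (bigD1 i) ?inE // [in RHS](bigD1 i) //= ti /= add0n.
  rewrite add0n; apply: eq_big => [j|j /andP[_ /tj ->]]; first by rewrite inE.
  by case: (_ != 0).
by rewrite expn1 mulnC.
Qed.

Lemma f_le_sum_types : 0 < d -> f_ r n <=
  \sum_(u : typ | total u == d) singleton_cost u +
  \sum_(t : typ | (total t == r) && ~~ absorbed t) full_cost t.
Proof.
move=> d0; apply: f_le; apply: decomp_ext sum_profiles _; apply: decompD.
  by apply: decomp_sum => u /eqP; apply: decomp_singleton.
by apply: decomp_sum => t /andP[/eqP tr wt]; apply: decomp_full.
Qed.

(** Such a type is determined by a list of d - 1 cells with their entries, repeating
    cells if needed. *)
Lemma card_small_supp : 0 < m ->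
  #|[set t : typ | #|supp t| < d]| <= (m * r.+1) ^ d.-1.
Proof.
move=> m0; pose dec (g : {ffun 'I_d.-1 -> 'I_m * 'I_r.+1}) : typ :=
  [ffun i => if [pick l | (g l).1 == i] is Some l then (g l).2 else ord0].
have <- : #|{ffun 'I_d.-1 -> 'I_m * 'I_r.+1}| = (m * r.+1) ^ d.-1.
  by rewrite card_ffun card_prod !card_ord.
rewrite -cardsT; apply: leq_trans (leq_imset_card dec _); apply: subset_leq_card.
apply/subsetP => t; rewrite inE => td; apply/imsetP.
pose p (l : 'I_d.-1) := nth (Ordinal m0) (enum (supp t)) l.
exists [ffun l => (p l, t (p l))]; rewrite ?inE //; apply/ffunP => i; rewrite ffunE.
case: pickP => [l|]; first by rewrite ffunE => /eqP /= <-.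
move=> no; apply: val_inj => /=; apply/eqP; apply: contraT => ti.
have i_supp : i \in enum (supp t) by rewrite mem_enum inE.
have lt_i : index i (enum (supp t)) < d.-1.
  by apply: leq_trans (_ : size (enum (supp t)) <= _); rewrite ?index_mem // -cardE; case: d td.
by have := no (Ordinal lt_i); rewrite ffunE /= /p /= nth_index // eqxx.
Qed.

Lemma card_subsets : #|[set I : {set 'I_m} | #|I| == d]| = 'C(m, d).
Proof. by rewrite card_draws card_ord. Qed.

Lemma card_flat : #|[set u : typ | (total u == d) && [forall i, u i <= 1]]| <= 'C(m, d).
Proof.
pose dec I : typ := [ffun i => inord (i \in I)].
rewrite -card_subsets; apply: leq_trans (leq_imset_card dec _).
apply: subset_leq_card; apply/subsetP => u; rewrite inE => /andP[/eqP ud /forallP u1].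
have uE i : u i = (i \in supp u) :> nat.
  by rewrite inE; have := u1 i; case: (u i : nat) => [|[]].
apply/imsetP; exists (supp u); rewrite ?inE.
  rewrite -sum1_card -[X in _ == X]ud -sum_supp; apply/eqP/eq_bigr => i iu.
  by rewrite uE iu.
apply/ffunP => i; rewrite ffunE; apply: val_inj; rewrite /= inordK ?uE //.
by case: (_ \in _); rewrite // rE.
Qed.

Lemma card_full : #|[set t : typ | [&& total t == r, ~~ absorbed t, halves t == d
    & [forall i, t i <= 3]]]| <= d * 'C(m, d).
Proof.
pose dec (q : {set 'I_m} * 'I_m) : typ :=
  [ffun i => inord (if i == q.2 then 3 else (i \in q.1).*2)].
pose D := [set q : {set 'I_m} * 'I_m | (#|q.1| == d) && (q.2 \in q.1)].
have <- : #|D| = d * 'C(m, d).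
  rewrite -sum1_card -card_subsets mulnC -sum_nat_const.
  transitivity (\sum_(q : {set 'I_m} * 'I_m | (#|q.1| == d) && (q.2 \in q.1)) 1).
    by apply: eq_bigl => q; rewrite inE.
  rewrite -(pair_big_dep (fun I => #|I| == d) (fun I i => i \in I) (fun _ _ => 1)) /=.
  by apply: eq_big => [I|I /eqP Id]; [rewrite inE | rewrite sum1_card].
apply: leq_trans (leq_imset_card dec _); apply: subset_leq_card; apply/subsetP => t.
rewrite inE => /and4P[/eqP tr wt /eqP hd /forallP t3].
have [i oi] := odd_part tr hd; have [ti tj] := full_part tr hd wt t3 oi.
apply/imsetP; exists (supp t, i).
  rewrite !inE ti andbT /= -sum1_card -[X in _ == X]hd /halves.
  rewrite [X in _ == X](bigID (mem (supp t))) /= [X in _ + X]big1 ?addn0; last first.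
    by move=> j; rewrite inE negbK => /eqP ->.
  apply/eqP/eq_bigr => j; rewrite inE => tj0.
  have [->|ji] := eqVneq j i; first by rewrite ti.
  by rewrite tj // tj0.
apply/ffunP => j; rewrite ffunE; apply: val_inj => /=.
have tjE : t j = (if j == i then 3 else (j \in supp t).*2) :> nat.
  by have [->|ji] := eqVneq j i; rewrite ?ti // {1}tj // inE.
by rewrite inordK -tjE.
Qed.

(** If the halves add up to d and one of them exceeds 1, fewer than d cells are
    occupied (a type that is not absorbed has no entry 1, so its occupied cells all
    have a positive half); [card_small_supp] bounds the number of these types. *)
Lemma f_le_type_count : 0 < d -> 0 < m -> f_ r n <=
  'C(m, d) * pair_cost k d + d * 'C(m, d) * (L * pair_cost k d.-1)
  + (2 * (m * r.+1) ^ d.-1 * L ^ d + r.+1 ^ m * L ^ d.-1).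
Proof.
move=> d0 m0; apply: leq_trans (f_le_sum_types d0) _.
have sum_const (P : pred typ) (F : typ -> nat) (S : {set typ}) c b :
    (forall t, P t -> t \in S) -> (forall t, P t -> F t = c) -> #|S| <= b ->
    \sum_(t | P t) F t <= b * c.
  move=> PS Fc Sb; rewrite (eq_bigr (fun=> c)) // sum_nat_const leq_mul2r; apply/orP; right.
  by apply: leq_trans Sb; apply: subset_leq_card; apply/subsetP => t; apply: PS.
have small_supp (t : typ) (w : 'I_m -> nat) i : \sum_j w j = d ->
    (forall j, t j != 0 :> nat -> 0 < w j) -> 1 < w i -> #|supp t| < d.
  move=> wd w0 wi; rewrite -wd -sum1_card big_mkcond.
  rewrite (bigD1 i) //= [X in _ < X](bigD1 i) //= -addSn.
  apply: leq_add; first by case: ifP => // _; apply: ltnW.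
  by apply: leq_sum => j _; case: ifP; rewrite // inE => /w0.
have A : \sum_(u : typ | total u == d) singleton_cost u <=
    'C(m, d) * pair_cost k d + (m * r.+1) ^ d.-1 * L ^ d.
  rewrite (bigID (fun u : typ => [forall i, u i <= 1])) /=; apply: leq_add.
    apply: sum_const card_flat => [u uP|u /andP[_ u1]]; first by rewrite inE.
    by rewrite /singleton_cost u1.
  apply: sum_const (card_small_supp m0) => [u /andP[/eqP ud]|u /andP[_ /negPf u1]].
    rewrite negb_forall => /existsP[i]; rewrite -ltnNge inE => ui.
    by apply: (small_supp u (fun j => u j) i) => // j; rewrite lt0n.
  by rewrite /singleton_cost u1.
have B : \sum_(t : typ | (total t == r) && ~~ absorbed t) full_cost t <=
    d * 'C(m, d) * (L * pair_cost k d.-1) + (m * r.+1) ^ d.-1 * L ^ d + r.+1 ^ m * L ^ d.-1.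
  rewrite (bigID (fun t : typ => halves t == d)) /=; apply: leq_add; last first.
    apply: (sum_const _ _ setT) => [t|t /andP[_ /negPf td]|]; rewrite ?inE //.
      by rewrite /full_cost td.
    by rewrite cardsT card_ffun !card_ord.
  rewrite (bigID (fun t : typ => [forall i, t i <= 3])) /=; apply: leq_add.
    apply: sum_const card_full => [t|t /andP[/andP[_ td] t3]].
      by rewrite inE -!andbA.
    by rewrite /full_cost td t3.
  apply: sum_const (card_small_supp m0) => [t|t /andP[/andP[_ td] /negPf t3]]; last first.
    by rewrite /full_cost td t3.
  move=> /andP[/andP[/andP[_ wt] /eqP hd]].
  rewrite negb_forall => /existsP[i]; rewrite -ltnNge inE => ti.
  apply: (small_supp t (fun j => (t j)./2) i) => // [j tj|]; last by move: ti; lia.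
  move: wt; rewrite /absorbed hd eqxx /= negb_exists => /forallP/(_ j).
  by move: tj; case: (t j : nat) => [|[|]].
apply: leq_trans (leq_add A B) _; rewrite mulnDl; lia.
Qed.

End Types.

(** * Asymptotics *)

From mathcomp Require Import all_order all_algebra.
From mathcomp Require Import all_classical all_reals all_analysis.
From mathcomp Require Import ring lra.

Import Order.TTheory GRing.Theory Num.Theory.
Import numFieldNormedType.Exports.

(** The cells are intervals of 15 k + 1 consecutive vertices. *)
Lemma f_le_pieces n m d k : (0 < d)%N -> (0 < m)%N -> (n <= m * (15 * k).+1)%N ->
  (f_ d.*2.+1 n <= 'C(m, d) * pair_cost k d
      + d * 'C(m, d) * ((15 * k).+1 * pair_cost k d.-1)
    + (2 * (m * d.*2.+2) ^ d.-1 * (15 * k).+1 ^ d + d.*2.+2 ^ m * (15 * k).+1 ^ d.-1))%N.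
Proof.
move=> d0 m0 nm; set L := (15 * k).+1 in nm *.
have lt_piece (x : 'I_n) : (x %/ L < m)%N by rewrite ltn_divLR // (leq_trans _ nm).
pose piece x := Ordinal (lt_piece x).
apply: (@f_le_type_count n m d k piece) => // i.
pose g (x : 'I_n) : 'I_L := inord (x %% L).
have g_inj : {in [pred x | piece x == i] &, injective g}.
  move=> x y; rewrite !inE => /eqP xi /eqP yi /(congr1 val); rewrite /= !inordK ?ltn_pmod // => xy.
  apply: val_inj => /=; rewrite (divn_eq x L) (divn_eq y L) xy.
  by move/(congr1 val): xi => /= ->; move/(congr1 val): yi => /= ->.
rewrite cardsE -(card_in_imset g_inj) -[X in (_ <= X)%N](card_ord L).
exact: max_card.
Qed.

Lemma ffact_le_exp n d : (n ^_ d <= n ^ d)%N.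
Proof.
elim: d n => // d IHd n; rewrite ffactnS expnS leq_mul2l; apply/orP; right.
by apply: leq_trans (IHd _) _; case: d {IHd} => // d; rewrite leq_exp2r ?leq_pred.
Qed.

Lemma ffact_ge_exp n d : ((n - d) ^ d <= n ^_ d)%N.
Proof.
elim: d => // d IHd; rewrite ffactnSr expnSr leq_mul //; last by rewrite leq_sub2l.
by apply: leq_trans IHd; case: d => // d; rewrite leq_exp2r // leq_sub2l.
Qed.

Local Open Scope ring_scope.

Section Arithmetic.

Variable R : realFieldType.
Implicit Types (x s : R).

Let q : R := 14%:R / 15%:R.

(** With j the floor of (d - 1) / 2 the sum is at most (2 j + 3) q ^ j, which decreases
    in j and is about 0.97 at j = 73. *)
Lemma savings_lt1 d : (147 <= d)%N -> q ^+ d./2 + d%:R * q ^+ d.-1./2 < 1.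
Proof.
move=> d147; have q0 : 0 <= q by rewrite /q; lra.
have q1 : q <= 1 by rewrite /q; lra.
have key j : (73 <= j)%N -> (2 * j + 3)%N%:R * q ^+ j < 1.
  elim: j => // j IHj; rewrite leq_eqVlt => /orP[/eqP <-|].
    by rewrite /q; lra.
  rewrite ltnS => j73; apply: le_lt_trans (IHj j73).
  rewrite exprS mulrA ler_wpM2r ?exprn_ge0 // !natrD !natrM -[j.+1%:R]natr1 /q.
  have : 73%:R <= j%:R :> R by rewrite ler_nat.
  lra.
apply: le_lt_trans (key d.-1./2 _); last by lia.
have dj : (d <= 2 * d.-1./2 + 2)%N by lia.
have qj : q ^+ d./2 <= q ^+ d.-1./2 by apply: ler_wiXn2l => //; lia.
have : 0 <= (2 * d.-1./2 + 2 - d)%N%:R * q ^+ d.-1./2 by rewrite mulr_ge0 ?exprn_ge0.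
rewrite natrB // (natrD _ _ 2) (natrD _ _ 3) natrM; lra.
Qed.

Lemma pair_cost_le k d : (pair_cost k d)%:R <= q ^+ d./2 * (15 * k).+1%:R ^+ d :> R.
Proof.
rewrite /pair_cost natrM !natrX -{4}(odd_double_half d) addnC exprD mulrA.
rewrite ler_wpM2r ?exprn_ge0 // -mul2n exprM -exprMn lerXn2r ?nnegrE //.
  by rewrite mulr_ge0 ?exprn_ge0 //; rewrite /q; lra.
rewrite natrM natrX -[(15 * k).+1%:R]natr1 natrM /q; have : 0 <= k%:R :> R by [].
nra.
Qed.

(** Bernoulli's inequality for (1 - s / x) ^ d, cleared of denominators. *)
Lemma exp_sub_ge x s d : 0 <= s <= x -> x ^+ d * (x - d%:R * s) <= (x - s) ^+ d * x.
Proof.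
move=> /andP[s0 sx]; elim: d => [|d IHd]; first by rewrite !expr0 mul0r subr0.
have x0 : 0 <= x by apply: le_trans sx.
have /(ler_wpM2r (_ : 0 <= x - s)) := IHd; rewrite subr_ge0 => /(_ sx) H.
have : 0 <= x ^+ d * (d%:R * s * s) by rewrite !mulr_ge0 ?exprn_ge0.
rewrite !exprSr -natr1; lra.
Qed.

End Arithmetic.

(** Multiplied by d!, the bound of [f_le_pieces] is at most
    (h + A / m) N ^ d + B N ^ (d - 1) with h < 1 the limiting ratio, N = n + 16 m an
    upper bound of m L, and A, B independent of n, A also of m; while d! binom(n, d)
    is at least (n - d) ^ d.  Fixing first m, then a lower bound for n, makes the
    error terms smaller than the gap 1 - h. *)
Lemma f_le_binomial (R : archiRealFieldType) d : (147 <= d)%N ->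
  exists c : R, [/\ 0 < c, c < 1 & exists n0, forall n, (n0 <= n)%N ->
    (f_ d.*2.+1 n)%:R <= c * 'C(n, d)%:R].
Proof.
move=> d147; have d0 : (0 < d)%N by apply: leq_trans d147.
pose q : R := 14%:R / 15%:R.
have q0 : 0 <= q by rewrite /q; lra.
pose h := q ^+ d./2 + d%:R * q ^+ d.-1./2.
have h1 : h < 1 by apply: savings_lt1.
have h0 : 0 <= h by rewrite addr_ge0 ?mulr_ge0 ?exprn_ge0.
pose A : R := (2 * d`! * d.*2.+2 ^ d.-1)%N%:R.
(* this many cells make the non-generic types cost at most a quarter of the gap *)
pose m := (Num.bound (4%:R * A / (1 - h))).+1.
have mA : A / m%:R <= (1 - h) / 4%:R.
  have m0 : 0 < m%:R :> R by rewrite ltr0n.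
  rewrite ler_pdivrMr //.
  have : 4%:R * A / (1 - h) < m%:R.
    apply: (lt_trans (y := (Num.bound (4%:R * A / (1 - h)))%:R)); last by rewrite ltr_nat.
    by apply: archi_boundP; rewrite divr_ge0 ?mulr_ge0 // subr_ge0 ltW.
  rewrite ltr_pdivrMr ?subr_gt0 //; lra.
pose B : R := (d`! * d.*2.+2 ^ m)%N%:R.
(* half of the gap is left to c, and a quarter to the lower order terms in n *)
pose c := (1 + h) / 2%:R.
have c0 : 0 < c by rewrite /c; lra.
exists c; split; rewrite ?/c; [by []|lra|].
pose s := (16 * m + d)%N.
pose n1 := Num.bound (4%:R * (B + c * (d%:R * s%:R)) / (1 - h)).
exists (maxn n1 d) => n; rewrite geq_max => /andP[n1n dn].
pose k := (n %/ (15 * m)).+1; pose L := (15 * k).+1.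
have nmL : (n <= m * L)%N by rewrite /L /k; have := ltn_ceil n (isT : 0 < 15 * m.+1)%N; nia.
have mLN : (m * L <= n + 16 * m)%N by rewrite /L /k; have := leq_trunc_div n (15 * m); nia.
pose N : R := (n + 16 * m)%N%:R.
have N0 : 0 < N by rewrite /N ltr0n /m; lia.
have mL : m%:R * L%:R <= N by rewrite -natrM ler_nat.
have dN : 0 < d`!%:R * N by rewrite mulr_gt0 // ltr0n fact_gt0.
have fN : (f_ d.*2.+1 n)%:R * d`!%:R * N <= N ^+ d * ((h + A / m%:R) * N + B).
  have m0 : 0 < m%:R :> R by rewrite ltr0n.
  pose l : R := L%:R; pose M := 'C(m, d)%:R * d`!%:R : R.
  have l0 : 0 <= l by [].
  have MN : M * l ^+ d <= N ^+ d.
    apply: le_trans (_ : m%:R ^+ d * l ^+ d <= _).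
      by rewrite ler_wpM2r ?exprn_ge0 // /M -natrM bin_ffact -natrX ler_nat ffact_le_exp.
    by rewrite -exprMn lerXn2r ?nnegrE ?mulr_ge0 // ltW.
  have dE : l ^+ d = l * l ^+ d.-1 by rewrite -exprS prednK.
  have t1 : M * (pair_cost k d)%:R <= q ^+ d./2 * N ^+ d.
    apply: le_trans (_ : q ^+ d./2 * (M * l ^+ d) <= _).
      by rewrite mulrCA ler_wpM2l ?mulr_ge0 // pair_cost_le.
    by rewrite ler_wpM2l ?exprn_ge0.
  have t2 : M * (l * (pair_cost k d.-1)%:R) <= q ^+ d.-1./2 * N ^+ d.
    apply: le_trans (_ : q ^+ d.-1./2 * (M * l ^+ d) <= _).
      rewrite dE mulrCA [X in _ <= X]mulrCA [X in _ <= M * X]mulrCA [X in X <= _]mulrCA.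
      by rewrite ler_wpM2l ?mulr_ge0 // ler_wpM2l // pair_cost_le.
    by rewrite ler_wpM2l ?exprn_ge0.
  have t3 : (2 * (m * d.*2.+2) ^ d.-1 * L ^ d)%N%:R * d`!%:R <= A / m%:R * N ^+ d.
    rewrite -(ler_pM2r m0) [X in _ <= X]mulrAC divfK ?gt_eqF //.
    apply: le_trans (_ : A * (m%:R * l) ^+ d <= _).
      rewrite /A /l -!natrM -natrX -natrM ler_nat; apply: eq_leq.
      have md : (m ^ d = m * m ^ d.-1)%N by rewrite -expnS prednK.
      by rewrite !expnMn md; ring.
    by rewrite ler_wpM2l // lerXn2r ?nnegrE ?mulr_ge0 // ltW.
  have t4 : (d.*2.+2 ^ m * L ^ d.-1)%N%:R * d`!%:R * N <= B * N ^+ d.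
    have -> : (d.*2.+2 ^ m * L ^ d.-1)%N%:R * d`!%:R * N = B * (l ^+ d.-1 * N).
      by rewrite /B /l !natrM (natrX _ L); ring.
    have -> : N ^+ d = N ^+ d.-1 * N by rewrite -exprSr prednK.
    rewrite ler_wpM2l // ler_pM2r // lerXn2r ?nnegrE ?(ltW N0) //.
    by apply: le_trans mL; rewrite ler_peMl // ler1n.
  have := f_le_pieces d0 (isT : 0 < m)%N nmL; rewrite -/L -(ler_nat R) !natrD.
  rewrite -(ler_pM2r dN) mulrA => /le_trans; apply.
  have s1 := ler_wpM2r (ltW N0) t1.
  have s2 := ler_wpM2r (ltW N0) (ler_wpM2l (ler0n R d) t2).
  have s3 := ler_wpM2r (ltW N0) t3.
  rewrite [X in (X + _ + _) * _]natrM [X in (_ + X + _) * _]natrM.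
  rewrite [X in (_ + X * _ + _) * _]natrM [X in (_ + _ * X + _) * _]natrM.
  move: s1 s2 s3 t4; rewrite /M /h /l; lra.
have CN : N ^+ d * (N - d%:R * s%:R) <= 'C(n, d)%:R * d`!%:R * N.
  have sN : (0 : R) <= s%:R <= N by apply/andP; split; [exact: ler0n | rewrite /N ler_nat /s; lia].
  apply: le_trans (exp_sub_ge d sN) _; rewrite ler_pM2r // -natrM bin_ffact.
  rewrite /N /s -natrB; last by lia.
  rewrite -natrX ler_nat; apply: leq_trans (ffact_ge_exp n d).
  by rewrite (_ : n + 16 * m - _ = n - d)%N //; lia.
rewrite -(ler_pM2r dN) mulrA.
rewrite (_ : _ * _ * (d`!%:R * N) = c * ('C(n, d)%:R * d`!%:R * N)); last by rewrite !mulrA.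
apply: le_trans fN _; apply: le_trans (ler_wpM2l (ltW c0) CN).
rewrite mulrCA ler_pM2l ?exprn_gt0 //.
have : 4%:R * (B + c * (d%:R * s%:R)) <= N * (1 - h).
  rewrite -ler_pdivrMr ?subr_gt0 //; apply: ltW; apply: lt_le_trans (_ : n1%:R <= _).
    apply: archi_boundP; rewrite divr_ge0 ?subr_ge0 ?(ltW h1) //.
    by rewrite mulr_ge0 // addr_ge0 // mulr_ge0 // ltW.
  by rewrite ler_nat; lia.
have : (h + A / m%:R) * N <= (h + (1 - h) / 4%:R) * N by rewrite ler_wpM2r ?(ltW N0) // lerD2l.
rewrite /c; lra.
Qed.

Local Open Scope classical_set_scope.
Local Open Scope ring_scope.

Theorem corollary2 (R : realType) (r : nat) (hr : (295 <= r)%N) (hodd : odd r) :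
  exists c : R, c < 1 /\
    exists eps : nat -> R, eps @ \oo --> (0 : R) /\
      forall n : nat, (r <= n)%N ->
        (f_ r n)%:R <= c * (1 + eps n) * ('C(n, r./2))%:R.
Proof.
have rE : r = r./2.*2.+1 by rewrite -[LHS]odd_double_half hodd.
have d147 : (147 <= r./2)%N by lia.
have [c [c0 c1 [n0 f_le_c]]] := f_le_binomial R d147.
exists c; split=> //.
(* the finitely many n below n0 do not affect the limit, so eps may be large there *)
exists (fun n => if (n0 <= n)%N then 0 else (f_ r n)%:R / c); split.
  apply: cvg_near_cst; exists n0 => // n /= n0n; by rewrite n0n.
move=> n rn; have [n0n|n0n] := leqP n0 n.
  by rewrite addr0 mulr1 {1}rE; apply: f_le_c.
have C1 : 1 <= 'C(n, r./2)%:R :> R.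
  by rewrite ler1n bin_gt0 (leq_trans _ rn) //; lia.
rewrite mulrDr mulr1 [c * (_ / c)]mulrC divfK ?gt_eqF //.
have : 0 <= (c + (f_ r n)%:R) * ('C(n, r./2)%:R - 1).
  by rewrite mulr_ge0 ?subr_ge0 // addr_ge0 // ltW.
lra.
Qed.
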